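(* Let $q>9$ be an odd prime power and let $U$ be an intersecting family of $q^2-\varepsilon$ polynomials over $\mathbb{F}_q$ of degree at most $2$, where $\varepsilon<\frac{q\sqrt{q}}{4}-\frac{3q}{8}-\frac{\sqrt{q}}{8}$. Then the graphs of the polynomials in $U$ share a common point.
   Context: The graph of $f\colon\mathbb{F}_q\to\mathbb{F}_q$ is $\{(x,f(x)):x\in\mathbb{F}_q\}$. A set of polynomials over $\mathbb{F}_q$ is intersecting if the graphs of any two of its members share at least one point. *)

(* Defs.v *)
From Stdlib Require Import Reals.
From mathcomp Require Import all_boot all_order all_algebra all_field.
Set Implicit Arguments. Unset Strict Implicit. Unset Printing Implicit Defensive.
Import GRing.Theory.
Local Open Scope ring_scope.

(* A finite family of polynomials is a duplicate-free sequence U. *)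
Definition intersecting (F : finFieldType) (U : seq {poly F}) : Prop :=
  forall f g, f \in U -> g \in U -> exists x : F, f.[x] = g.[x].

Definition common_point (F : finFieldType) (U : seq {poly F}) : Prop :=
  exists x y : F, forall f, f \in U -> f.[x] = y.

(* Main.v *)
(** The polynomial [a x^2 + b x + c] is the triple [f = (a, b, c)]; its value at
[x] is the pairing of [f] with the point [(x^2, x, 1)] of a conic.  For a
linear form [xi], let the excess of [xi] be the number of collisions of [xi] on
[U^2] minus its least possible value [u^2 / q], where [u = #|U|]; it is
nonnegative.  Two distinct members of [U] meet in one or two points, so
[J^2 - 3 J + 2 = 0] for the number [J] of common points, and this ties the
collisions on pairs of conic points to those on single conic points.  Every form
off the conic (completed by [(1, 0, 0)]) lies on at least [(q - 3) / 2] secants, so summing the excess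
over secants bounds the excess carried by the conic from below: its sum [W]
over the conic satisfies [W >= u^2 - q u].

Let [N(x, y)] be the number of members of [U] through [(x, y)], and
[h = N - u / q].  For [f] in [U] put [H(f) = sum_x h(x, f(x))]; these numbers
add up to [W], so [sum_f H(f)^2 >= W^2 / u].  Expanding the square, the
diagonal part is at most [W max N], and the off-diagonal part only sees the
part of the joint distribution of [(f(x), f(x'))] that is not explained by its
marginals, whose energy is at most about [u (q^2 - u + 4)].  Hence [max N] is
at least roughly [u - q - sqrt (u (q^2 - u + 4))].  On the other hand at most
[(q - 1) (q + 2) / 2] polynomials through [(x, y)] meet a given polynomial
that misses [(x, y)]; for the present [u], the bound on [max N] exceeds this,
so some point is missed by no member of [U]. *)
Require Import Defs.
From Stdlib Require Import Reals.
From mathcomp Require Import all_boot all_order all_algebra all_field.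
From mathcomp Require Import all_fingroup all_solvable Rstruct.
From mathcomp Require Import ring lra.
Set Implicit Arguments. Unset Strict Implicit. Unset Printing Implicit Defensive.
Import Order.TTheory GRing.Theory Num.Theory.
Local Open Scope ring_scope.

(** * Cauchy-Schwarz and sums of indicators *)

Section Sums.
Variable K : realFieldType.

(** Lagrange's identity: the double sum of the squares [(a i * b j - a j * b i) ^+ 2] is twice the
    gap between the two sides. *)
Lemma cauchy_schwarz_sum (I : finType) (P : pred I) (a b : I -> K) :
  (\sum_(i | P i) a i * b i) ^+ 2 <=
  (\sum_(i | P i) a i ^+ 2) * (\sum_(i | P i) b i ^+ 2).
Proof.
have h : 0 <= \sum_(i | P i) \sum_(j | P j) (a i * b j - a j * b i) ^+ 2.
  by do 2 (apply: sumr_ge0 => ? _); apply: sqr_ge0.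
have e (A := \sum_(i | P i) a i ^+ 2) (B := \sum_(i | P i) b i ^+ 2)
    (C := \sum_(i | P i) a i * b i) :
  \sum_(i | P i) \sum_(j | P j) (a i * b j - a j * b i) ^+ 2 =
    A * B + B * A - (C * C + C * C).
  rewrite !big_distrlr -!big_split -sumrB; apply: eq_bigr => i _ /=.
  by rewrite -!big_split -sumrB; apply: eq_bigr => j _ /=; ring.
rewrite e in h.
lra.
Qed.

Lemma sqr_sum_le_card (I : finType) (a : I -> K) :
  (\sum_i a i) ^+ 2 <= #|I|%:R * \sum_i a i ^+ 2.
Proof.
have := cauchy_schwarz_sum predT (fun _ : I => 1) a.
under eq_bigr do rewrite mul1r.
by under [X in _ <= X * _]eq_bigr do rewrite expr1n; rewrite sumr_const.
Qed.

Lemma sum_eq1 (T : finType) (y : T) : \sum_z (z == y)%:R = 1 :> K.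
Proof. by rewrite (bigD1 y) //= eqxx big1 ?addr0 // => z /negbTE->. Qed.

Lemma sum_eq_mul (T : finType) (y : T) (h : T -> K) : \sum_z (y == z)%:R * h z = h y.
Proof.
by rewrite (bigD1 y) //= eqxx mul1r big1 ?addr0 // => z; rewrite eq_sym => /negbTE->; rewrite mul0r.
Qed.

End Sums.

(** * Linear forms on quadratics, the conic and its secants *)

Section Conic.
Variables (F : finFieldType) (K : realFieldType).
Local Notation vec := (F * F * F)%type.
Local Notation q := (#|F|%:R : K).

Definition dot (xi f : vec) : F := xi.1.1 * f.1.1 + xi.1.2 * f.1.2 + xi.2 * f.2.
Definition moment (x : F) : vec := (x ^+ 2, x, 1).
Definition comb (r : F) (xi : vec) (t : F) (zeta : vec) : vec :=
  (r * xi.1.1 + t * zeta.1.1, r * xi.1.2 + t * zeta.1.2, r * xi.2 + t * zeta.2).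
(** The cone over the conic: the multiples of [(1, 0, 0)] and of the points [moment x]. *)
Definition isotropic (xi : vec) := xi.1.2 ^+ 2 == xi.1.1 * xi.2.
Definition agree (f g : vec) : nat := #|[pred x | dot (moment x) f == dot (moment x) g]|.

Lemma dot_comb r xi t zeta f : dot (comb r xi t zeta) f = r * dot xi f + t * dot zeta f.
Proof. rewrite /dot /=; ring. Qed.

Lemma card_roots (p : {poly F}) : p != 0 -> (#|[pred x | root p x]| < size p)%N.
Proof.
move=> p0; rewrite cardE; apply: max_poly_roots => //; last exact: enum_uniq.
by apply/allP => x; rewrite mem_enum.
Qed.

Lemma size_quad (c b a : F) : (size (Poly [:: c; b; a]) <= 3)%N.
Proof. exact: size_Poly. Qed.

Lemma dot_moment_horner (f : vec) x :
  dot (moment x) f = (Poly [:: f.2; f.1.2; f.1.1]).[x].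
Proof. by rewrite horner_Poly /= /dot /=; ring. Qed.

Lemma agree_le2 f g : f != g -> (agree f g <= 2)%N.
Proof.
move=> fg; set p := Poly [:: f.2; f.1.2; f.1.1] - Poly [:: g.2; g.1.2; g.1.1].
have p0 : p != 0.
  apply: contra fg; rewrite subr_eq0 => /eqP e.
  have h i := congr1 (fun r : {poly F} => r`_i) e.
  have := h 0; have := h 1%N; have := h 2; rewrite !coef_Poly /=.
  by case: f {p e h} => [[a b] c]; case: g => [[a' b'] c'] /= -> -> ->.
have sp : (size p <= 3)%N.
  by rewrite (leq_trans (size_polyD _ _)) // size_polyN geq_max !size_quad.
rewrite -ltnS (leq_trans _ sp) // (leq_ltn_trans _ (card_roots p0)) //.
apply/subset_leq_card/subsetP => x; rewrite !inE !dot_moment_horner rootE.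
by rewrite hornerD hornerN subr_eq0.
Qed.

Lemma sum_affine_root (d e : F) : d != 0 -> \sum_x ((x * d + e == 0)%:R : K) = 1.
Proof.
move=> d0; rewrite -[RHS](sum_eq1 K (- e / d)); apply: eq_bigr => x _.
suff -> : (x * d + e == 0) = (x == - e / d) by [].
by rewrite addr_eq0; apply/eqP/eqP => [<-|->]; rewrite ?mulfK ?divfK.
Qed.

Lemma sum_nz (h : F -> K) : \sum_(r | r != 0) h r = \sum_r h r - h 0.
Proof. by rewrite [in RHS](bigD1 0) //= addrC addrK. Qed.

(** The right side packs three cases: [(q - 1) ^+ 2] if both coefficients vanish, 0 if exactly one
    does, [q - 1] if neither does. *)
Lemma sum_nz_comb (a b : F) :
  \sum_(r | r != 0) \sum_(t | t != 0) ((r * a + t * b == 0)%:R : K) =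
  (q - 1) * (q * ((a == 0) && (b == 0))%:R + 1 - (a == 0)%:R - (b == 0)%:R).
Proof.
have cq : \sum_(r : F | r != 0) (1 : K) = q - 1 by rewrite sum_nz sumr_const.
case: (eqVneq b 0) => [->|b0]; case: (eqVneq a 0) => [->|a0] /=.
- under eq_bigr do under eq_bigr do rewrite !mulr0 addr0 eqxx.
  by under eq_bigr do rewrite cq; rewrite -[q - 1 in LHS]mul1r -mulr_suml cq; ring.
- rewrite big1 => [|r r0]; first by ring.
  by rewrite big1 // => t t0; rewrite mulr0 addr0 mulf_eq0 (negbTE r0) (negbTE a0).
- rewrite big1 => [|r r0]; first by ring.
  by rewrite big1 // => t t0; rewrite mulr0 add0r mulf_eq0 (negbTE t0) (negbTE b0).
- rewrite (eq_bigr (fun _ => 1)) ?cq => [|r r0]; first by ring.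
  rewrite sum_nz mul0r addr0 mulf_eq0 (negbTE r0) (negbTE a0) subr0.
  by under eq_bigr do rewrite addrC; exact: sum_affine_root.
Qed.

Lemma sum_vec (h : vec -> K) : \sum_xi h xi = \sum_a \sum_b \sum_c h (a, b, c).
Proof.
by rewrite pair_bigA pair_bigA; apply: eq_bigr => -[[a b] c] _.
Qed.

(** For [f != g] the forms that do not separate them make up a plane: summing first over a
    coordinate where [f] and [g] differ leaves one solution. *)
Lemma sum_dot_eq (f g : vec) :
  \sum_xi ((dot xi f == dot xi g)%:R : K) = if f == g then q ^+ 3 else q ^+ 2.
Proof.
have c1 : \sum_(x : F) (1 : K) = q by rewrite sumr_const.
have cc (c : K) : \sum_(x : F) c = q * c by rewrite -c1 mulr_suml; under [RHS]eq_bigr do rewrite mul1r.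
case: (eqVneq f g) => [->|fg].
  by under eq_bigr do rewrite eqxx; rewrite sumr_const !card_prod !natrM; ring.
have E a b c : (dot (a, b, c) f == dot (a, b, c) g) =
    (a * (f.1.1 - g.1.1) + b * (f.1.2 - g.1.2) + c * (f.2 - g.2) == 0).
  by rewrite -subr_eq0 /dot /=; congr (_ == 0); ring.
rewrite sum_vec; under eq_bigr do under eq_bigr do under eq_bigr do rewrite E.
have [e3|n3] := eqVneq f.2 g.2; last first.
  under eq_bigr do under eq_bigr do under eq_bigr do rewrite addrC.
  by under eq_bigr do under eq_bigr do rewrite sum_affine_root ?subr_eq0 //; rewrite !cc; ring.
have [e2|n2] := eqVneq f.1.2 g.1.2; last first.
  under eq_bigr do rewrite exchange_big /=.
  under eq_bigr do under eq_bigr do under eq_bigr do rewrite addrAC addrC.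
  by under eq_bigr do under eq_bigr do rewrite sum_affine_root ?subr_eq0 //; rewrite !cc; ring.
have [e1|n1] := eqVneq f.1.1 g.1.1.
  by move: fg e1 e2 e3; case: f {E} => [[? ?] ?]; case: g => [[? ?] ?] /= /eqP h *; case: h; congr (_, _, _).
rewrite exchange_big /=; under eq_bigr do rewrite exchange_big /=.
under eq_bigr do under eq_bigr do under eq_bigr do rewrite -addrA.
by under eq_bigr do under eq_bigr do rewrite sum_affine_root ?subr_eq0 //; rewrite !cc; ring.
Qed.

(** When the last coordinate [r] is nonzero, write the middle one as [r * x]; the cone equation then
    forces the first. *)
Lemma sum_isotropic (h : vec -> K) :
  \sum_(xi | isotropic xi) h xi =
  h (0, 0, 0) + \sum_(r | r != 0) h (r, 0, 0) +
  \sum_x \sum_(r | r != 0) h (r * x ^+ 2, r * x, r).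
Proof.
rewrite big_mkcond sum_vec exchange_big /=.
under eq_bigr do rewrite exchange_big /=.
rewrite exchange_big /= [in LHS](bigD1 0) //=; congr (_ + _).
  rewrite [in LHS](bigD1 0) //= [X in _ + X]big1 ?addr0 => [|b b0]; last first.
    by rewrite big1 // => a _; rewrite /isotropic /= mulr0 expf_eq0 (negbTE b0).
  under eq_bigr do rewrite /isotropic /= mulr0 expr0n /= eqxx.
  by rewrite [LHS](bigD1 0).
rewrite [in RHS]exchange_big; apply: eq_bigr => c c0 /=.
rewrite [LHS](reindex (fun x => c * x)) /=; last first.
  by exists (fun x => x / c) => x _; [rewrite mulrC mulKf | rewrite mulrC divfK].
apply: eq_bigr => x _; rewrite (bigD1 (c * x ^+ 2)) //= big1 => [|a]; last first.
  rewrite /isotropic /=; case: ifP => // /eqP e /eqP na; case: na; apply: (mulIf c0).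
  by rewrite -e; ring.
by rewrite addr0 /isotropic /=; case: eqP => // ne; case: ne; ring.
Qed.

(** If [2 = 0], the additive group is an elementary abelian 2-group, so [#|F|] is a power of 2
    greater than 1. *)
Lemma card_odd_two_neq0 : odd #|F| -> (2%:R : F) != 0.
Proof.
move=> oddF; apply/eqP => two0; have F2 : 2 \in [pchar F] by rewrite inE /= two0.
have /card_pgroup := abelem_pgroup (fin_ring_pchar_abelem F2).
rewrite cardsT => cF; move: oddF (finNzRing_gt1 F); rewrite cF.
by case: (logn _ _) => // n; rewrite expnS oddM.
Qed.

(* [p = (x, x', r, t)] encodes the vector [r * moment x + t * moment x'] on the
secant through two distinct conic points. *)
Definition secant_data (p : F * F * F * F) : bool :=
  [&& p.1.1.2 != p.1.1.1, p.1.2 != 0 & p.2 != 0].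
Definition secant_point (p : F * F * F * F) : vec :=
  comb p.1.2 (moment p.1.1.1) p.2 (moment p.1.1.2).

(** Each first endpoint [x] has one candidate second endpoint. It fails only if [x] is a root of
    [lin] (vanishing denominator) or of [quad] (coinciding endpoints), which excludes at most
    [1 + 2] values. Odd order keeps [quad] nonzero. *)
Lemma card_secants (xi : vec) : odd #|F| -> ~~ isotropic xi ->
  (#|F| <= #|[pred p | secant_data p && (secant_point p == xi)]| + 3)%N.
Proof.
move=> oddF; case: xi => [[a b] c]; rewrite /isotropic /= => iso.
pose lin := Poly [:: - b; c]; pose quad := Poly [:: a; - b *+ 2; c].
have linE x : lin.[x] = c * x - b by rewrite horner_Poly /=; ring.
have quadE x : quad.[x] = c * x ^+ 2 - b * x *+ 2 + a by rewrite horner_Poly /=; ring.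
have two0 := card_odd_two_neq0 oddF.
have lin0 : lin != 0.
  apply: contra iso => /eqP e.
  have := coef_Poly [:: - b; c] 0; have := coef_Poly [:: - b; c] 1%N.
  by rewrite -/lin e !coef0 /= => <- /esym/eqP; rewrite oppr_eq0 => /eqP ->; rewrite mulr0 expr0n.
have quad0 : quad != 0.
  apply: contra iso => /eqP e.
  have := coef_Poly [:: a; - b *+ 2; c] 0; have := coef_Poly [:: a; - b *+ 2; c] 1%N.
  rewrite -/quad e !coef0 /= => /esym/eqP; rewrite -mulr_natl mulf_eq0 (negbTE two0) oppr_eq0 => /eqP-> <-.
  by rewrite mul0r expr0n.
have bad : (#|[pred x | root (lin * quad) x]| <= 3)%N.
  rewrite -ltnS; apply: leq_trans (card_roots (mulf_neq0 lin0 quad0)) _.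
  apply: leq_trans (size_polyMleq _ _) _.
  have := size_Poly [:: - b; c]; have := size_Poly [:: a; - b *+ 2; c].
  rewrite -/lin -/quad /= => h1 h2; rewrite -subn1 leq_subLR.
  by apply: leq_trans (leq_add h2 h1) _.
rewrite -(cardC [pred x | root (lin * quad) x]) addnC leq_add //.
(* [(a, b, c)] lies on the line through [moment x] and [moment x'] iff
   [a - b (x + x') + c x x' = 0]; solve for [x']. *)
pose y x := (b * x - a) / (c * x - b).
pose phi x : F * F * F * F := (x, y x, (c * y x - b) / (y x - x), (b - c * x) / (y x - x)).
have phi_inj : injective phi by move=> x x' [].
rewrite -(card_image phi_inj); apply/subset_leq_card/subsetP => p /imageP[x].
rewrite !inE /secant_data /secant_point rootE hornerM mulf_eq0 negb_or linE quadE => /andP[nl nq] ->{p} /=.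
have yx : y x - x = - (c * x ^+ 2 - b * x *+ 2 + a) / (c * x - b).
  by rewrite /y; field.
have yx0 : y x - x != 0 by rewrite yx mulf_neq0 ?oppr_eq0 ?invr_neq0.
(* Both weights are nonzero: this one because [b ^+ 2 != a * c] off the conic, the other because [x]
   is not a root of [lin]. *)
have cy : c * y x - b = (b ^+ 2 - a * c) / (c * x - b) by rewrite /y; field.
have cy0 : c * y x - b != 0 by rewrite cy mulf_neq0 ?invr_neq0 // subr_eq0.
rewrite -subr_eq0 yx0 !mulf_neq0 ?invr_neq0 //=; last by rewrite -opprB oppr_eq0.
apply/eqP; rewrite /comb /moment /=.
have e1 : y x * (c * x - b) = b * x - a by rewrite /y divfK.
congr (_, _, _); [clear yx cy cy0|by field|by field].
move: (y x) yx0 e1 => z zx0 e1; apply: (mulIf zx0); apply/eqP; rewrite -subr_eq0.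
have -> : ((c * z - b) / (z - x) * x ^+ 2 + (b - c * x) / (z - x) * z ^+ 2) * (z - x)
    - a * (z - x) = (z * (c * x - b) - (b * x - a)) * (x - z) by field.
by rewrite e1 subrr mul0r.
Qed.

End Conic.

(** * Fibres, collisions and excess of a family of triples *)

Section Family.
Variables (F : finFieldType) (K : realFieldType).
Local Notation vec := (F * F * F)%type.
Local Notation q := (#|F|%:R : K).

Variable U : {set vec}.
Local Notation u := (#|U|%:R : K).

Definition fib (xi : vec) (y : F) : K := \sum_(f in U) (dot xi f == y)%:R.
Definition coll (xi : vec) : K :=
  \sum_(f in U) \sum_(g in U) (dot xi f == dot xi g)%:R.
Definition excess (xi : vec) : K := coll xi - u ^+ 2 / q.

Lemma q_gt0 : 0 < q.
Proof. by rewrite ltr0n; apply/card_gt0P; exists 0. Qed.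

Lemma q_neq0 : q != 0.
Proof. by rewrite gt_eqF ?q_gt0. Qed.

Lemma sum_fib_mul xi (h : F -> K) :
  \sum_y fib xi y * h y = \sum_(f in U) h (dot xi f).
Proof.
under eq_bigr do rewrite mulr_suml.
by rewrite exchange_big; apply: eq_bigr => f _ /=; rewrite sum_eq_mul.
Qed.

Lemma sum_fib xi : \sum_y fib xi y = u.
Proof.
have := sum_fib_mul xi (fun=> 1); rewrite sumr_const => <-.
by apply: eq_bigr => y _; rewrite mulr1.
Qed.

Lemma coll_fib xi : coll xi = \sum_y fib xi y ^+ 2.
Proof.
under [RHS]eq_bigr do rewrite expr2; rewrite sum_fib_mul.
by apply: eq_bigr => f _; apply: eq_bigr => g _; rewrite eq_sym.
Qed.

(** Cauchy-Schwarz over the [q] fibres, whose sizes add up to [u]. *)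
Lemma excess_ge0 xi : 0 <= excess xi.
Proof.
rewrite subr_ge0 ler_pdivrMr ?q_gt0 // mulrC coll_fib -(sum_fib xi).
exact: sqr_sum_le_card.
Qed.

Lemma excess_scale r a b c : r != 0 -> excess (r * a, r * b, r * c) = excess (a, b, c).
Proof.
move=> r0.
have E h : dot (r * a, r * b, r * c) h = r * dot (a, b, c) h.
  by rewrite /dot /=; ring.
rewrite /excess /coll; under eq_bigr do under eq_bigr do rewrite !E (inj_eq (mulfI r0)).
by [].
Qed.

Lemma sum_card1 : \sum_(f in U) (1 : K) = u.
Proof. by rewrite sumr_const. Qed.

Lemma sum_pair_const (c : K) : \sum_(f in U) \sum_(g in U) c = u ^+ 2 * c.
Proof. by rewrite !sumr_const -mulrnA -[LHS]mulr_natl natrM expr2. Qed.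

Lemma sum_pair_diag (c : K) : \sum_(f in U) \sum_(g in U) (f == g)%:R * c = u * c.
Proof.
rewrite -sum_card1 mulr_suml; apply: eq_bigr => f fU.
rewrite mul1r (bigD1 f) //= eqxx mul1r big1 ?addr0 // => g /andP[_].
by rewrite eq_sym => /negbTE->; rewrite mul0r.
Qed.

Lemma excess0 : excess (0, 0, 0) = u ^+ 2 - u ^+ 2 / q.
Proof.
rewrite /excess /coll; under eq_bigr do under eq_bigr do
  rewrite /dot /= !mul0r eqxx.
by rewrite sum_pair_const mulr1.
Qed.

(** Counted by pairs [(f, g)], only the diagonal stands out, so the total depends on [u] alone; the
    cone is later subtracted from it. *)
Lemma sum_excess : \sum_xi excess xi = q ^+ 2 * (q - 1) * u.
Proof.
rewrite sumrB sumr_const !card_prod -[_ *+ (_ * _)]mulr_natl !natrM.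
rewrite exchange_big; under eq_bigr do rewrite exchange_big /=.
under eq_bigr do under eq_bigr do rewrite sum_dot_eq.
rewrite (eq_bigr (fun f => \sum_(g in U) (q ^+ 2 + (f == g)%:R * (q ^+ 3 - q ^+ 2)))); last first.
  by move=> f _; apply: eq_bigr => g _; case: ifP => _; rewrite ?mul0r ?mul1r ?addr0 // addrC subrK.
under eq_bigr do rewrite big_split; rewrite big_split /= sum_pair_const sum_pair_diag.
by have q0 := q_neq0; field.
Qed.

(** * Common points of pairs of members *)

Definition agreements : K := \sum_x coll (moment x).
Definition wsum : K := \sum_x excess (moment x).

Lemma wsumE : wsum = agreements - u ^+ 2.
Proof. by rewrite /wsum sumrB sumr_const -[_ *+ _]mulr_natl mulrC divfK ?q_neq0. Qed.

Lemma agreeE (f g : vec) : (agree f g)%:R = \sum_x ((dot (moment x) f == dot (moment x) g)%:R : K).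
Proof.
rewrite /agree -sum1_card natr_sum big_mkcond; apply: eq_bigr => x _.
by rewrite inE; case: (_ == _).
Qed.

Lemma agree_refl (f : vec) : agree f f = #|F|.
Proof. by apply: eq_card => x; rewrite !inE eqxx. Qed.

Lemma agreements_agree : agreements = \sum_(f in U) \sum_(g in U) (agree f g)%:R.
Proof.
rewrite /agreements /coll exchange_big; apply: eq_bigr => f _.
by rewrite exchange_big; apply: eq_bigr => g _; rewrite agreeE.
Qed.

Definition pairs : K := \sum_(f in U) \sum_(g in U) (agree f g)%:R * ((agree f g)%:R - 1).

Lemma sum_agree_pairs (f g : vec) (z := fun x => (dot (moment x) f == dot (moment x) g)) :
  \sum_x \sum_(x' | x' != x) (((z x && z x')%:R) : K) = (agree f g)%:R * ((agree f g)%:R - 1).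
Proof.
rewrite mulrBr mulr1 agreeE big_distrlr /= -sumrB; apply: eq_bigr => x _.
rewrite [X in _ = X - _](bigD1 x) //= -natrM mulnb andbb -/(z x) addrAC subrr add0r.
by apply: eq_bigr => x' _; rewrite -natrM mulnb.
Qed.

(** * Excess along secants and the bounds on [wsum] *)

Lemma sum_secants (h : vec -> K) :
  \sum_(p | secant_data p) h (secant_point p) =
  \sum_x \sum_(x' | x' != x) \sum_(r | r != 0) \sum_(t | t != 0)
    h (comb r (moment x) t (moment x')).
Proof.
by rewrite !pair_big_dep; apply: eq_big => [[[[x x'] r] t]|] //; rewrite /secant_data /= andbA.
Qed.

Lemma sum_fcst (c : K) : \sum_(x : F) c = q * c.
Proof. by rewrite sumr_const -[LHS]mulr_natl. Qed.

Lemma sum_fcst_neq (x : F) (c : K) : \sum_(y | y != x) c = (q - 1) * c.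
Proof. by rewrite mulrBl mul1r -sum_fcst [X in _ = X - _](bigD1 x) //= addrAC subrr add0r. Qed.

(** For fixed endpoints the number of weights depends only on which endpoints are common points of
    [f] and [g], so the total is a polynomial in [a]. *)
Lemma sum_secants_dot (f g : vec) (a := (agree f g)%:R : K) :
  \sum_(p | secant_data p) ((dot (secant_point p) f == dot (secant_point p) g)%:R : K) =
  (q - 1) * (q * (a * (a - 1)) + q * (q - 1) - 2 * (q - 1) * a).
Proof.
pose v x := dot (moment x) f - dot (moment x) g.
rewrite (sum_secants (fun xi => (dot xi f == dot xi g)%:R)).
have E x x' r t : (dot (comb r (moment x) t (moment x')) f ==
     dot (comb r (moment x) t (moment x')) g) = (r * v x + t * v x' == 0).
  by rewrite -subr_eq0 !dot_comb /v; congr (_ == 0); ring.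
under eq_bigr do under eq_bigr do under eq_bigr do under eq_bigr do rewrite E.
under eq_bigr do under eq_bigr do rewrite sum_nz_comb.
under eq_bigr do rewrite -mulr_sumr 2!sumrB big_split /= -mulr_sumr sum_fcst_neq mulr1.
rewrite -mulr_sumr 2!sumrB big_split /= -mulr_sumr sum_fcst.
under eq_bigr do rewrite sum_fcst_neq.
rewrite -mulr_sumr.
have vE x : (v x == 0) = (dot (moment x) f == dot (moment x) g) by rewrite subr_eq0.
under [X in _ * X + _ - _ - _]eq_bigr do under eq_bigr do rewrite !vE.
rewrite sum_agree_pairs -/a.
have sv : \sum_x ((v x == 0)%:R : K) = a by rewrite /a agreeE; under eq_bigr do rewrite vE.
rewrite sv.
have -> : \sum_x \sum_(x' | x' != x) ((v x' == 0)%:R : K) = (q - 1) * a.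
  rewrite mulrBl mul1r -{2}sv -[in q * a]sv -sum_fcst -sumrB; apply: eq_bigr => x _.
  by rewrite [X in _ = X - _](bigD1 x) //= addrAC subrr add0r.
by ring.
Qed.

Lemma sum_secants_excess :
  \sum_(p | secant_data p) excess (secant_point p) =
  (q - 1) * (q * pairs + (q - 1) * u ^+ 2 - 2 * (q - 1) * agreements).
Proof.
have cst (c : K) : \sum_(p : F * F * F * F | secant_data p) c = q * ((q - 1) * ((q - 1) * ((q - 1) * c))).
  rewrite (sum_secants (fun=> c)).
  under eq_bigr do under eq_bigr do under eq_bigr do rewrite sum_fcst_neq.
  under eq_bigr do under eq_bigr do rewrite sum_fcst_neq.
  by under eq_bigr do rewrite sum_fcst_neq; rewrite sum_fcst.
rewrite sumrB cst exchange_big /=; under eq_bigr do rewrite exchange_big /=.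
under eq_bigr do under eq_bigr do rewrite sum_secants_dot.
have lin (c1 c2 c3 c4 : K) (X Y : vec -> vec -> K) :
    \sum_(f in U) \sum_(g in U) c1 * (c2 * X f g + c3 - c4 * Y f g) =
    c1 * (c2 * (\sum_(f in U) \sum_(g in U) X f g) + u ^+ 2 * c3
          - c4 * (\sum_(f in U) \sum_(g in U) Y f g)).
  rewrite -sum_pair_const !mulr_sumr -big_split -sumrB mulr_sumr.
  apply: eq_bigr => f _ /=; rewrite !mulr_sumr -big_split -sumrB mulr_sumr.
  by apply: eq_bigr => g _.
rewrite lin -agreements_agree.
by rewrite -/pairs; have q0 := q_neq0; field.
Qed.

(** Members with equal leading and linear coefficients differ by a constant; sharing a point, they
    coincide. So at most [q] members share a leading coefficient. *)
Lemma excess_inf_le : (forall f g : vec, f \in U -> g \in U -> (0 < agree f g)%N) ->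
  excess (1, 0, 0) <= q * u - u ^+ 2 / q.
Proof.
move=> meet; rewrite lerD2r /coll -sum_card1 mulr_sumr; apply: ler_sum => f fU; rewrite mulr1.
rewrite -natr_sum ler_nat -big_mkcondr sum1_card.
rewrite -(card_in_imset (f := fun g : vec => g.1.2)).
  exact: max_card.
move=> g h; rewrite !unfold_in => /andP[gU /eqP eg] /andP[hU /eqP eh] e.
have {eg eh} : g.1.1 = h.1.1.
  by move: (etrans (esym eg) eh); rewrite /dot /= !mul1r !mul0r !addr0.
have /card_gt0P[x] := meet _ _ gU hU; rewrite !inE.
case: g h e {gU hU} => [[a b] c] [[a' b'] c'] /= <- /[swap] <-.
by rewrite /dot /= !mul1r => /eqP/addrI ->.
Qed.

(** Off the diagonal the agreement number [J] is 1 or 2, so [J * (J - 1) = 2 * J - 2]; on the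
    diagonal [J = q], with discrepancy [(q - 1) * (q - 2)]. *)
Lemma pairs_agreements : (forall f g : vec, f \in U -> g \in U -> (0 < agree f g)%N) ->
  pairs = 2 * agreements - 2 * u ^+ 2 + (q - 1) * (q - 2) * u.
Proof.
move=> meet; rewrite agreements_agree mulr_sumr.
have -> : 2 * u ^+ 2 = \sum_(f in U) \sum_(g in U) 2 by rewrite sum_pair_const; ring.
rewrite [_ * u]mulrC -sum_pair_diag -sumrB -big_split; apply: eq_bigr => f fU /=.
rewrite mulr_sumr -sumrB -big_split; apply: eq_bigr => g gU /=.
case: (eqVneq f g) => [<-|fg]; first by rewrite agree_refl mul1r; ring.
have := meet f g fU gU; have := agree_le2 fg; rewrite mul0r.
by case: (agree f g) => [|[|[|]]] // _ _; ring.
Qed.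

Lemma agreements_le : agreements <= q * u + 2 * (u ^+ 2 - u).
Proof.
have -> : q * u + 2 * (u ^+ 2 - u) =
    \sum_(f in U) \sum_(g in U) (2 + (f == g)%:R * (q - 2)).
  under eq_bigr do rewrite big_split.
  by rewrite big_split /= sum_pair_diag sum_pair_const; ring.
rewrite agreements_agree; apply: ler_sum => f fU; apply: ler_sum => g gU.
case: (eqVneq f g) => [<-|fg]; first by rewrite agree_refl mul1r addrC subrK.
by rewrite mul0r addr0 ler_nat agree_le2.
Qed.

(** Subtract the cone from [sum_excess]. By [excess_inf_le], the zero form and the multiples of
    [(1, 0, 0)] together carry at most [q * (q - 1) * u]. *)
Lemma sum_noniso : (forall f g : vec, f \in U -> g \in U -> (0 < agree f g)%N) ->
  (q - 1) * (q * (q - 1) * u - wsum) <= \sum_(xi | ~~ isotropic xi) excess xi.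
Proof.
move=> /excess_inf_le inf.
have := sum_excess; rewrite (bigID (@isotropic F)) /= sum_isotropic excess0.
have E1 : \sum_(r | r != 0) excess (r, 0, 0) = (q - 1) * excess (1, 0, 0).
  rewrite -(sum_fcst_neq 0); apply: eq_bigr => r r0.
  by rewrite -[RHS](excess_scale _ _ _ r0) mulr1 mulr0.
have E2 : \sum_x \sum_(r | r != 0) excess (r * x ^+ 2, r * x, r) = (q - 1) * wsum.
  rewrite mulr_sumr; apply: eq_bigr => x _; rewrite -(sum_fcst_neq 0); apply: eq_bigr => r r0.
  by rewrite -[RHS](excess_scale _ _ _ r0) mulr1.
rewrite E1 E2 => e.
have q1 : 0 <= q - 1 by rewrite subr_ge0 ler1n; apply/card_gt0P; exists 0.
have := ler_wpM2l q1 inf.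
have q0 := q_neq0.
have -> : (q - 1) * (q * u - u ^+ 2 / q) = q * (q - 1) * u - (u ^+ 2 - u ^+ 2 / q) by field.
move: (u ^+ 2 / q) e => w2 e ?; lra.
Qed.

(** Each form off the cone comes from at least [q - 3] secant data, and the remaining terms are
    nonnegative. *)
Lemma sum_secants_ge : odd #|F| ->
  (q - 3) * \sum_(xi | ~~ isotropic xi) excess xi <=
  \sum_(p | secant_data p) excess (secant_point p).
Proof.
move=> oddF; rewrite [X in _ <= X](bigID (fun p => ~~ isotropic (secant_point p))) /=.
apply: ler_wpDr; first by apply: sumr_ge0 => p _; exact: excess_ge0.
rewrite [X in _ <= X](partition_big (@secant_point F) (fun xi => ~~ isotropic xi)) /=; last first.
  by move=> p /andP[].
rewrite mulr_sumr; apply: ler_sum => xi iso.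
rewrite (eq_bigr (fun _ => excess xi)) => [|p /andP[_ /eqP ->] //].
rewrite sumr_const -[X in _ <= X]mulr_natl ler_wpM2r ?excess_ge0 // lerBlDr -natrD ler_nat.
apply: leq_trans (card_secants oddF iso) _; rewrite leq_add2r.
apply/subset_leq_card/subsetP => p; rewrite !unfold_in /= => /andP[-> /eqP e].
by rewrite e iso eqxx.
Qed.

Lemma wsum_ge : odd #|F| -> (forall f g : vec, f \in U -> g \in U -> (0 < agree f g)%N) ->
  u ^+ 2 - q * u <= wsum.
Proof.
move=> oddF meet.
have q3 : 3 <= q.
  by rewrite ler_nat ltn_neqAle finNzRing_gt1 andbT; apply: contraTneq oddF => <-.
have := sum_secants_ge oddF; rewrite sum_secants_excess pairs_agreements //.
have := ler_wpM2l _ (sum_noniso meet); rewrite -subr_ge0 in q3; move=> /(_ _ q3) h1 h2.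
have {h1 h2} := le_trans h1 h2; have := wsumE.
move: wsum agreements => w T ->.
have q1 : 0 < q - 1 by lra.
rewrite -subr_ge0 => h.
(* With [pairs] and [wsum] eliminated, the inequality carries the factor [(q - 1) ^+ 2]. *)
have : 0 <= (q - 1) ^+ 2 * (T - u ^+ 2 - (u ^+ 2 - q * u)) by lra.
by rewrite pmulr_rge0 ?exprn_gt0 // subr_ge0.
Qed.

Lemma wsum_le : wsum <= u ^+ 2 + (q - 2) * u.
Proof. by rewrite wsumE; have := agreements_le; lra. Qed.

(** * Second moments of the deviations *)

Lemma cauchy_schwarz_sum4 (a b : F -> F -> F -> F -> K) :
  (\sum_x \sum_(x' | x' != x) \sum_y \sum_y' a x x' y y' * b x x' y y') ^+ 2 <=
  (\sum_x \sum_(x' | x' != x) \sum_y \sum_y' a x x' y y' ^+ 2) *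
  (\sum_x \sum_(x' | x' != x) \sum_y \sum_y' b x x' y y' ^+ 2).
Proof. rewrite !pair_big_dep; exact: cauchy_schwarz_sum. Qed.

Definition dev x y : K := fib (moment x) y - u / q.

Lemma sum_dev x : \sum_y dev x y = 0.
Proof. by rewrite sumrB sum_fib sum_fcst mulrC divfK ?q_neq0 // subrr. Qed.

Lemma sum_fib_dev x : \sum_y fib (moment x) y * dev x y = excess (moment x).
Proof.
rewrite /excess coll_fib; under eq_bigr do rewrite mulrBr.
by rewrite sumrB -mulr_suml sum_fib mulrA -expr2.
Qed.

Lemma sum_dev2 x : \sum_y dev x y ^+ 2 = excess (moment x).
Proof.
rewrite -sum_fib_dev; under [LHS]eq_bigr do rewrite expr2 {1}/dev mulrBl.
by rewrite sumrB -mulr_sumr sum_dev mulr0 subr0.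
Qed.

Definition joint x x' y y' : K :=
  \sum_(f in U) (dot (moment x) f == y)%:R * (dot (moment x') f == y')%:R.

Lemma sum_joint_mul x x' (h : F -> F -> K) :
  \sum_y \sum_y' joint x x' y y' * h y y' =
  \sum_(f in U) h (dot (moment x) f) (dot (moment x') f).
Proof.
under eq_bigr do under eq_bigr do rewrite mulr_suml.
under eq_bigr do rewrite exchange_big.
rewrite exchange_big; apply: eq_bigr => f _ /=.
under eq_bigr do under eq_bigr do rewrite -mulrA.
by under eq_bigr do rewrite -mulr_sumr sum_eq_mul; rewrite sum_eq_mul.
Qed.

(* The part of the joint count orthogonal to the functions of [y] alone and of
[y'] alone. *)
Definition resid x x' y y' : K := joint x x' y y' - dev x y / q - dev x' y' / q - u / q ^+ 2.

(** The terms removed from [joint] depend on at most one of [y], [y'], and each [dev] sums to zero,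
    so they are orthogonal to the product of deviations. *)
Lemma sum_resid_dev x x' :
  \sum_y \sum_y' resid x x' y y' * (dev x y * dev x' y') =
  \sum_(f in U) dev x (dot (moment x) f) * dev x' (dot (moment x') f).
Proof.
rewrite -(sum_joint_mul x x' (fun y y' => dev x y * dev x' y')).
apply/eqP; rewrite -subr_eq0 -sumrB; under eq_bigr do rewrite -sumrB.
rewrite (eq_bigr (fun y => (- (dev x y ^+ 2 / q) - u / q ^+ 2 * dev x y) * \sum_y' dev x' y'
   - dev x y / q * excess (moment x'))) => [|y _]; last first.
  rewrite -sum_dev2 !mulr_sumr -sumrB; apply: eq_bigr => y' _; rewrite /resid; ring.
under eq_bigr do rewrite sum_dev mulr0 sub0r.
by rewrite sumrN -2!mulr_suml sum_dev !mul0r oppr0.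
Qed.

(** Pythagoras: the removed part [t] has the same inner product with [joint] as with itself, so its
    energy is subtracted. *)
Lemma sum_resid2 x x' :
  \sum_y \sum_y' resid x x' y y' ^+ 2 =
  \sum_(f in U) \sum_(g in U) (((dot (moment x) f == dot (moment x) g) &&
      (dot (moment x') f == dot (moment x') g))%:R : K)
  - excess (moment x) / q - excess (moment x') / q - u ^+ 2 / q ^+ 2.
Proof.
have q0 : q != 0 := q_neq0.
pose t y y' := dev x y / q + dev x' y' / q + u / q ^+ 2.
have -> : \sum_y \sum_y' resid x x' y y' ^+ 2 =
    \sum_y \sum_y' joint x x' y y' * joint x x' y y' -
    2 * (\sum_y \sum_y' joint x x' y y' * t y y') + \sum_y \sum_y' t y y' ^+ 2.
  rewrite mulr_sumr -sumrB -big_split; apply: eq_bigr => y _ /=.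
  rewrite mulr_sumr -sumrB -big_split; apply: eq_bigr => y' _ /=.
  by rewrite /resid /t; ring.
rewrite sum_joint_mul (sum_joint_mul _ _ t) /t.
have -> : \sum_(f in U) joint x x' (dot (moment x) f) (dot (moment x') f) =
  \sum_(f in U) \sum_(g in U) (((dot (moment x) f == dot (moment x) g) &&
      (dot (moment x') f == dot (moment x') g))%:R : K).
  apply: eq_bigr => f _; apply: eq_bigr => g _.
  by rewrite -natrM mulnb eq_sym (eq_sym (dot (moment x') f)).
have sd z : \sum_(f in U) dev z (dot (moment z) f) = excess (moment z).
  by rewrite -sum_fib_mul sum_fib_dev.
have -> : \sum_(f in U) (dev x (dot (moment x) f) / q + dev x' (dot (moment x') f) / q + u / q ^+ 2) =
    excess (moment x) / q + excess (moment x') / q + u ^+ 2 / q ^+ 2.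
  rewrite !big_split /= -!mulr_suml !sd sumr_const -[_ *+ _]mulr_natl; ring.
have -> : \sum_y \sum_y' (dev x y / q + dev x' y' / q + u / q ^+ 2) ^+ 2 =
    excess (moment x) / q + excess (moment x') / q + u ^+ 2 / q ^+ 2.
  (* The terms of the square that are linear in [dev x' y'] are collected in front of a zero sum. *)
  rewrite (eq_bigr (fun y => (dev x y ^+ 2 / q + excess (moment x') / q ^+ 2 + u ^+ 2 / q ^+ 3 +
      2 * u / q ^+ 2 * dev x y)
      + (2 * dev x y / q ^+ 2 + 2 * u / q ^+ 3) * \sum_y' dev x' y')) => [|y _]; last first.
    have e1 : dev x y ^+ 2 / q = \sum_(y' : F) dev x y ^+ 2 / q ^+ 2 by rewrite sum_fcst; field.
    have e2 : u ^+ 2 / q ^+ 3 = \sum_(y' : F) u ^+ 2 / q ^+ 4 by rewrite sum_fcst; field.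
    have e3 : 2 * u / q ^+ 2 * dev x y = \sum_(y' : F) 2 * u / q ^+ 3 * dev x y
      by rewrite sum_fcst; field.
    rewrite e1 e2 e3 -sum_dev2 mulr_suml mulr_sumr -!big_split.
    by apply: eq_bigr => y' _ /=; field.
  under eq_bigr do rewrite sum_dev mulr0 addr0.
  have sd2 : \sum_y dev x y ^+ 2 / q = excess (moment x) / q by rewrite -mulr_suml sum_dev2.
  by rewrite !big_split /= sd2 !sum_fcst -mulr_sumr sum_dev; field.
ring.
Qed.

Definition resid_energy : K :=
  \sum_x \sum_(x' | x' != x) \sum_y \sum_y' resid x x' y y' ^+ 2.

Lemma resid_energyE : resid_energy = pairs - 2 * (q - 1) * wsum / q - (q - 1) * u ^+ 2 / q.
Proof.
have q0 : q != 0 := q_neq0.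
rewrite /resid_energy; under eq_bigr do under eq_bigr do rewrite sum_resid2.
under eq_bigr do rewrite !sumrB !sum_fcst_neq.
rewrite !sumrB sum_fcst -mulr_sumr -mulr_suml.
have -> : \sum_x \sum_(x' | x' != x) excess (moment x') / q = (q - 1) * (wsum / q).
  have -> : wsum / q = \sum_x excess (moment x) / q by rewrite mulr_suml.
  rewrite mulrBl mul1r -[X in X - _]sum_fcst -sumrB; apply: eq_bigr => x _.
  by rewrite [X in _ = X - _](bigD1 x) //= addrAC subrr add0r.
have -> : \sum_x \sum_(x' | x' != x) \sum_(f in U) \sum_(g in U)
   (((dot (moment x) f == dot (moment x) g) && (dot (moment x') f == dot (moment x') g))%:R : K) = pairs.
  under eq_bigr do rewrite exchange_big.
  rewrite exchange_big; apply: eq_bigr => f _.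
  under eq_bigr do rewrite exchange_big.
  by rewrite exchange_big; apply: eq_bigr => g _; exact: sum_agree_pairs.
by rewrite -/(wsum); field.
Qed.

Definition cross : K := \sum_x \sum_(x' | x' != x) \sum_(f in U)
  dev x (dot (moment x) f) * dev x' (dot (moment x') f).

(** Cauchy-Schwarz after replacing the joint counts by [resid]. It leaves products of excesses over
    [x' != x]; adding the diagonal gives [wsum ^+ 2]. *)
Lemma cross_sqr_le : cross ^+ 2 <= resid_energy * wsum ^+ 2.
Proof.
rewrite /cross; under eq_bigr do under eq_bigr do rewrite -sum_resid_dev.
apply: le_trans (cauchy_schwarz_sum4 _ _) _.
apply: ler_wpM2l; first by do 4 (apply: sumr_ge0 => ? _); exact: sqr_ge0.
rewrite expr2 big_distrlr; apply: ler_sum => x _ /=.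
rewrite [X in _ <= X](bigD1 x) //= addrC ler_wpDr ?mulr_ge0 ?excess_ge0 //.
apply: ler_sum => x' _; rewrite -!sum_dev2 big_distrlr /=.
by apply: ler_sum => y _; apply: ler_sum => y' _; rewrite exprMn.
Qed.

(** Cauchy-Schwarz for [H], whose sum over [U] is [wsum]. The diagonal of the square weighs
    [dev ^+ 2] by fibre sizes, at most [m]; the rest is [cross]. *)
Lemma wsum_sqr_le m : (forall x y, fib (moment x) y <= m) ->
  wsum ^+ 2 <= u * (m * wsum + cross).
Proof.
move=> fm; pose H f := \sum_x dev x (dot (moment x) f).
have HE : \sum_(f in U) 1 * H f = wsum.
  under [LHS]eq_bigr do rewrite mul1r.
  by rewrite exchange_big; apply: eq_bigr => x _; rewrite -sum_fib_mul sum_fib_dev.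
have := cauchy_schwarz_sum (mem U) (fun=> 1) H; rewrite HE => /le_trans; apply.
under eq_bigr do rewrite expr1n.
rewrite sum_card1 ler_wpM2l ?ler0n //.
have -> : \sum_(f in U) H f ^+ 2 = \sum_x \sum_(f in U) dev x (dot (moment x) f) ^+ 2 + cross.
  rewrite exchange_big /cross; under [X in _ + X]eq_bigr do rewrite exchange_big.
  rewrite [X in _ + X]exchange_big -big_split; apply: eq_bigr => f _ /=.
  rewrite expr2 big_distrlr -big_split; apply: eq_bigr => x _ /=.
  by rewrite (bigD1 x) //= expr2.
rewrite lerD2r mulr_sumr; apply: ler_sum => x _.
rewrite -sum_dev2 mulr_sumr -(sum_fib_mul (moment x) (fun y => dev x y ^+ 2)).
by apply: ler_sum => y _; rewrite ler_wpM2r ?sqr_ge0.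
Qed.

(** [wsum_sqr_le] bounds [(wsum - u * m) * wsum] by [u * cross]; after squaring, [cross_sqr_le] lets
    [wsum ^+ 2] cancel. *)
Lemma fib_max_bound m : (forall x y, fib (moment x) y <= m) ->
  0 < wsum -> u * m <= wsum -> (wsum - u * m) ^+ 2 <= u ^+ 2 * resid_energy.
Proof.
move=> /wsum_sqr_le h w0 um.
have h1 : (wsum - u * m) * wsum <= u * cross by lra.
rewrite -(ler_pM2r (exprn_gt0 2 w0)) -exprMn.
have h0 : 0 <= (wsum - u * m) * wsum by rewrite mulr_ge0 ?subr_ge0 // ltW.
apply: le_trans (_ : (u * cross) ^+ 2 <= _); first by rewrite ler_pXn2r // nnegrE // (le_trans h0).
by rewrite exprMn -[X in _ <= X]mulrA; apply: ler_wpM2l; rewrite ?sqr_ge0 ?cross_sqr_le.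
Qed.

(** * Quadratics through prescribed points *)

Lemma sum_reindex_vec (phi : vec -> vec) (h : vec -> K) : injective phi ->
  \sum_f h (phi f) = \sum_a \sum_b \sum_c h (a, b, c).
Proof. by move=> inj; rewrite -sum_vec [RHS](reindex_inj inj). Qed.

(** The leading coefficient and two values are coordinates on triples, so the leading coefficient
    stays free. *)
Lemma sum_two_values (x x' y y' : F) : x' != x ->
  \sum_f ((dot (moment x) f == y) && (dot (moment x') f == y'))%:R = q :> K.
Proof.
move=> xx'.
rewrite (sum_reindex_vec (phi := fun f => (f.1.1, dot (moment x) f, dot (moment x') f))
  (fun v => ((v.1.2 == y) && (v.2 == y'))%:R)) /=; last first.
  move=> [[a b] c] [[a' b'] c']; rewrite /dot /= => -[<- e1 e2].
  have : (b - b') * (x' - x) = 0.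
    have -> : (b - b') * (x' - x) =
        (x' ^+ 2 * a + x' * b + 1 * c - (x' ^+ 2 * a + x' * b' + 1 * c')) -
        (x ^+ 2 * a + x * b + 1 * c - (x ^+ 2 * a + x * b' + 1 * c')) by ring.
    by rewrite e1 e2 !subrr.
  move/eqP; rewrite mulf_eq0 !subr_eq0 (negbTE xx') orbF => /eqP eb; subst b'.
  by move: e1 => /addrI; rewrite !mul1r => ->.
under eq_bigr do under eq_bigr do under eq_bigr do rewrite -mulnb natrM.
under eq_bigr do under eq_bigr do rewrite -mulr_sumr sum_eq1 mulr1.
by under eq_bigr do rewrite sum_eq1; rewrite sumr_const.
Qed.

(** Interpolation: distinct quadratics agree at most twice, so three values are coordinates. *)
Lemma sum_three_values (x x' x'' y y' y'' : F) : x' != x -> x'' != x -> x'' != x' ->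
  \sum_f ([&& dot (moment x) f == y, dot (moment x') f == y' & dot (moment x'') f == y''])%:R = 1 :> K.
Proof.
move=> xx' xx'' xx3.
rewrite (sum_reindex_vec (phi := fun f => (dot (moment x) f, dot (moment x') f, dot (moment x'') f))
  (fun v => ([&& v.1.1 == y, v.1.2 == y' & v.2 == y''])%:R)) /=; last first.
  move=> f g [e1 e2 e3]; apply/eqP; apply: contraT => /agree_le2.
  rewrite leqNgt => /negP[]; pose s := [:: x; x'; x''].
  have us : uniq s by rewrite /= !inE negb_or eq_sym xx' eq_sym xx'' eq_sym xx3.
  rewrite -[3%N]/(size s) -(card_uniqP us); apply/subset_leq_card/subsetP => z.
  by rewrite !inE => /or3P[] /eqP ->; apply/eqP.
under eq_bigr do under eq_bigr do under eq_bigr do rewrite -!mulnb !natrM.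
under eq_bigr do under eq_bigr do rewrite -!mulr_sumr sum_eq1 mulr1.
by under eq_bigr do rewrite -mulr_sumr sum_eq1 mulr1; rewrite sum_eq1.
Qed.

(** Inclusion-exclusion over the points shared with [g]: each of the [q - 1] other abscissas allows
    [q] quadratics, each ordered pair of them one, giving [(q - 1) * q - (q - 1) * (q - 2) / 2]. *)
Lemma fib_le_missing (g : vec) x y : (forall f : vec, f \in U -> (0 < agree f g)%N) ->
  dot (moment x) g != y -> fib (moment x) y <= (q - 1) * (q + 2) / 2.
Proof.
move=> meet gy; pose A f := (agree f g)%:R : K.
have fg f : dot (moment x) f == y -> f != g by apply: contraL => /eqP ->.
(* [A - A (A - 1) / 2] is the indicator of [0 < A] for [A <= 2]. *)
apply: le_trans (_ : \sum_f (dot (moment x) f == y)%:R * (A f - A f * (A f - 1) / 2) <= _).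
  (* Outside [U], a quadratic through [(x, y)] still differs from [g], so it agrees with [g] at most
     twice and its term is nonnegative. *)
  rewrite [X in _ <= X](bigID (mem U)) /= ler_wpDr //.
    apply: sumr_ge0 => f _; rewrite /A; case: eqP => [/eqP/fg/agree_le2|_]; last by rewrite mul0r.
    by case: (agree f g) => [|[|[|]]] // _; rewrite mul1r; lra.
  apply: ler_sum => f /meet; rewrite /A; case: eqP => [/eqP/fg/agree_le2|_]; last by rewrite mul0r.
  by case: (agree f g) => [|[|[|]]] // _ _; rewrite -[true%:R]/(1 : K) mul1r; lra.
pose z x' f := dot (moment x') f == dot (moment x') g.
have zx f : (dot (moment x) f == y) && z x f = false.
  by apply/negP => /andP[/eqP e]; rewrite /z e eq_sym (negbTE gy).
have S1 : \sum_f (dot (moment x) f == y)%:R * A f = (q - 1) * q.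
  under eq_bigr do rewrite /A agreeE mulr_sumr.
  rewrite exchange_big (bigD1 x) //= big1 ?add0r => [|f _]; last by rewrite -natrM mulnb zx.
  rewrite -(sum_fcst_neq x); apply: eq_bigr => x' xx'.
  by under eq_bigr do rewrite -natrM mulnb; exact: sum_two_values.
have S2 : \sum_f (dot (moment x) f == y)%:R * (A f * (A f - 1)) = (q - 1) * (q - 2).
  under eq_bigr do rewrite /A -sum_agree_pairs mulr_sumr.
  rewrite exchange_big (bigD1 x) //= big1 ?add0r => [|f _]; last first.
    rewrite mulr_sumr big1 // => x' _; rewrite -natrM mulnb andbA.
    by have := zx f; rewrite /z => ->.
  rewrite -(sum_fcst_neq x); apply: eq_bigr => x' xx'.
  under eq_bigr do rewrite mulr_sumr.
  rewrite exchange_big (bigD1 x) 1?eq_sym //= big1 ?add0r => [|f _]; last first.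
    by rewrite -natrM mulnb andbCA; have := zx f; rewrite /z => ->; rewrite andbF.
  under eq_bigr => x'' /andP[n1 n2].
    under eq_bigr do rewrite -natrM mulnb.
    rewrite sum_three_values //; over.
  have := sum_fcst_neq x 1; rewrite mulr1 (bigD1 x') //= => e.
  under eq_bigl do rewrite andbC.
  lra.
rewrite (eq_bigr (fun f => (dot (moment x) f == y)%:R * A f
   - (dot (moment x) f == y)%:R * (A f * (A f - 1)) / 2)) => [|f _]; last by ring.
by rewrite sumrB -mulr_suml S1 S2; lra.
Qed.

(** Every point is missed by a member, so [m] bounds all fibres. In [fib_max_bound], [wsum_ge]
    serves the left side and [wsum_le] the energy, which increases with [wsum]; then [u ^+ 2]
    cancels. *)
Lemma spread_bound (m := (q - 1) * (q + 2) / 2) : odd #|F| ->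
  (forall f g : vec, f \in U -> g \in U -> (0 < agree f g)%N) ->
  (forall x y, exists2 g, g \in U & dot (moment x) g != y) ->
  0 < u -> m <= u - q ->
  (u - q - m) ^+ 2 <= 2 * (q - 2) * u / q + (q - 1) * (q - 2) * u - (q - 3) * u ^+ 2 / q.
Proof.
move=> oddF meet spread u0 mu.
have q_pos : 0 < q := q_gt0.
have q2 : 2 <= q by rewrite ler_nat finNzRing_gt1.
have m0 : 0 < m by rewrite divr_gt0 ?mulr_gt0 //; lra.
have fm x y : fib (moment x) y <= m.
  by have [g gU gy] := spread x y; apply: fib_le_missing gy => f fU; exact: meet.
clearbody m.
have w1 := wsum_ge oddF meet; have w2 := wsum_le.
have umw : u * m <= wsum.
  by apply: le_trans w1; have := ler_wpM2l (ltW u0) mu; lra.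
have := fib_max_bound fm (lt_le_trans (mulr_gt0 u0 m0) umw) umw.
have mono : (u * (u - q - m)) ^+ 2 <= (wsum - u * m) ^+ 2.
  have h0 : 0 <= u * (u - q - m) by rewrite mulr_ge0 ?(ltW u0) //; lra.
  have h1 : u * (u - q - m) <= wsum - u * m by lra.
  by rewrite ler_pXn2r // nnegrE // (le_trans h0).
move/(le_trans mono); rewrite exprMn ler_pM2l ?exprn_gt0 // => /le_trans; apply.
rewrite resid_energyE pairs_agreements //.
have qn : q != 0 := q_neq0.
have -> : 2 * agreements - 2 * u ^+ 2 + (q - 1) * (q - 2) * u - 2 * (q - 1) * wsum / q
    - (q - 1) * u ^+ 2 / q = 2 * wsum / q + (q - 1) * (q - 2) * u - (q - 1) * u ^+ 2 / q.
  by rewrite wsumE; field.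
have -> : 2 * (q - 2) * u / q + (q - 1) * (q - 2) * u - (q - 3) * u ^+ 2 / q =
    2 * (u ^+ 2 + (q - 2) * u) / q + (q - 1) * (q - 2) * u - (q - 1) * u ^+ 2 / q by field.
by rewrite !lerD2r ler_pM2r ?invr_gt0 // ler_pM2l.
Qed.

End Family.

(** * Numerical estimates at the threshold *)

Section Arithmetic.
Variable K : realFieldType.

(** Here [s] is the square root of [q]. Put [e = q ^+ 2 - u]. For [e > 0] the left side is at most
    [s ^+ 7 / 4], against a square of order [s ^+ 8]. *)
Lemma stability_arith (s u : K) : 0 < s -> 11 <= s ^+ 2 ->
  (s ^+ 2) ^+ 2 - u < s ^+ 2 * s / 4 - 3 * s ^+ 2 / 8 - s / 8 ->
  let q := s ^+ 2 in let m := (q - 1) * (q + 2) / 2 in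
  [/\ 0 < u, m <= u - q &
   2 * (q - 2) * u / q + (q - 1) * (q - 2) * u - (q - 3) * u ^+ 2 / q < (u - q - m) ^+ 2].
Proof.
move=> s0 sq he q m.
have s3 : 33 / 10 <= s.
  rewrite leNgt; apply/negP => h.
  have : s * s < (33/10) * (33/10) by apply: ltr_pM => //; apply: ltW.
  by rewrite -expr2; lra.
set e := (s ^+ 2) ^+ 2 - u in he.
have q0 : 0 < q by rewrite /q exprn_gt0.
have qn : q != 0 by rewrite gt_eqF.
have uE : u = q ^+ 2 - e by rewrite /e /q; ring.
have mE : u - q - m = (q ^+ 2 - 3 * q + 2) / 2 - e by rewrite uE /m; field.
have BE : 2 * (q - 2) * u / q + (q - 1) * (q - 2) * u - (q - 3) * u ^+ 2 / q =
    (q ^+ 2 - e) * (4 - 4 / q + e * (1 - 3 / q)) by rewrite uE; field.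
have iq : 0 < q^-1 by rewrite invr_gt0.
have iq3 : 3 / q <= 1 by rewrite ler_pdivrMr // mul1r /q; lra.
have s4 : 33 / 10 * s ^+ 3 <= s ^+ 4 by rewrite (exprS s 3) ler_wpM2r // exprn_ge0 // ltW.
have s23 : 33 / 10 * s ^+ 2 <= s ^+ 3 by rewrite (exprS s 2) ler_wpM2r // exprn_ge0 // ltW.
have s12 : 33 / 10 * s <= s ^+ 2 by rewrite expr2 ler_wpM2r // ltW.
have he' : e < s ^+ 3 / 4 - 3 * s ^+ 2 / 8 - s / 8.
  by apply: lt_le_trans he _; rewrite le_eqVlt; apply/orP; left; apply/eqP; ring.
have qE : q ^+ 2 = s ^+ 4 by rewrite /q -exprM.
have big : 3 / 10 * s ^+ 4 <= (q ^+ 2 - 3 * q + 2) / 2 - (s ^+ 3 / 4 - 3 * s ^+ 2 / 8 - s / 8).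
  rewrite qE /q; lra.
split.
- by rewrite uE qE; lra.
- rewrite -subr_ge0 mE; have : 0 <= s ^+ 4 by rewrite exprn_ge0 // ltW.
  by lra.
rewrite mE BE.
have [e0|e0] := lerP e 0.
  (* For [e <= 0] the term in [e] is dropped, and [(2 * q - e) ^+ 2 >= 4 * (q ^+ 2 - e)]
     suffices. *)
  have A0 : 2 * q <= (q ^+ 2 - 3 * q + 2) / 2 by rewrite /q in sq *; nra.
  move: (_ / 2) A0 => A A0.
  apply: le_lt_trans (_ : (q ^+ 2 - e) * (4 - 4 / q) < _).
    apply: ler_wpM2l; first by have := sqr_ge0 q; lra.
    by rewrite gerDl; apply: mulr_le0_ge0 => //; lra.
  have : (q ^+ 2 - e) * (4 - 4 / q) < (q ^+ 2 - e) * 4.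
    rewrite ltr_pM2l; first by rewrite gtrDl oppr_lt0 mulr_gt0.
    by have := exprn_gt0 2 q0; lra.
  have : (2 * q - e) ^+ 2 <= (A - e) ^+ 2 by rewrite ler_pXn2r // ?nnegrE; lra.
  have : 0 <= - e * (q - 1) by rewrite mulr_ge0 //; rewrite /q; lra.
  have := sqr_ge0 e; lra.
(* The lower-order terms of the hypothesis absorb the 4: [3 * s ^+ 2 / 8 > 4] because
   [s ^+ 2 >= 11]. *)
have h4 : 4 + e <= s ^+ 3 / 4 by lra.
have le1 : (q ^+ 2 - e) * (4 - 4 / q + e * (1 - 3 / q)) <= s ^+ 4 * (s ^+ 3 / 4).
  have eq0 : 0 <= e / q by rewrite divr_ge0 // ltW.
  have u0 : 0 <= q ^+ 2 - e by rewrite qE; lra.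
  apply: le_trans (_ : (q ^+ 2 - e) * (s ^+ 3 / 4) <= _).
    by apply: ler_wpM2l => //; lra.
  by apply: ler_wpM2r; rewrite ?qE; lra.
apply: le_lt_trans le1 _.
apply: lt_le_trans (_ : (3 / 10 * s ^+ 4) ^+ 2 <= _); last first.
  by rewrite ler_pXn2r // ?nnegrE; lra.
have s7 : 0 < s ^+ 7 by rewrite exprn_gt0.
have -> : (3 / 10 * s ^+ 4) ^+ 2 = 9 / 100 * s * s ^+ 7 by field.
have -> : s ^+ 4 * (s ^+ 3 / 4) = 1 / 4 * s ^+ 7 by field.
by rewrite ltr_pM2r //; lra.
Qed.

End Arithmetic.

(** * From polynomials to coefficient triples, and the conclusion *)

Section Coefficients.
Variable F : finFieldType.

Definition coefs (p : {poly F}) : F * F * F := (p`_2, p`_1, p`_0).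

Lemma horner_coefs (p : {poly F}) x : (size p <= 3)%N -> p.[x] = dot (moment x) (coefs p).
Proof.
by move=> sp; rewrite (horner_coef_wide x sp) !big_ord_recl big_ord0 /dot /=; ring.
Qed.

Lemma coefs_inj (p r : {poly F}) : (size p <= 3)%N -> (size r <= 3)%N ->
  coefs p = coefs r -> p = r.
Proof.
move=> sp sr [e2 e1 e0]; apply/polyP => -[|[|[|i]]] //.
by rewrite !nth_default // (leq_trans _ (leq_addr i 3)).
Qed.

End Coefficients.

Local Open Scope R_scope.

(* q = #|F| (a finite field's order is automatically a prime power); we
   require q odd and q > 9.  U is a family (duplicate-free list) of
   polynomials of degree <= 2 (size <= 3); #|U| = size U = q^2 - epsilon. *)
Theorem theorem4 (F : finFieldType) (U : seq {poly F}) :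
  odd #|F| -> (9 < #|F|)%N ->
  uniq U ->
  (forall f, f \in U -> (size f <= 3)%N) ->
  intersecting U ->
  (pow (INR #|F|) 2 - INR (size U) <
     INR #|F| * sqrt (INR #|F|) / 4 - 3 * INR #|F| / 8 - sqrt (INR #|F|) / 8) ->
  common_point U.
Proof.
move=> oddF q9 uU deg meetU hU.
pose V : {set F * F * F} := [set v in map (@coefs F) U].
have cV : #|V| = size U.
  rewrite cardsE; have /card_uniqP -> : uniq (map (@coefs F) U); last by rewrite size_map.
  by rewrite map_inj_in_uniq // => p r /deg sp /deg sr; exact: coefs_inj.
have memV v : v \in V -> exists2 p, p \in U & v = coefs p.
  by rewrite inE => /mapP.
have meet (f g : F * F * F) : f \in V -> g \in V -> (0 < agree f g)%N.
  move=> /memV[p pU ->] /memV[r rU ->]; have [x e] := meetU _ _ pU rU.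
  by apply/card_gt0P; exists x; rewrite inE -!horner_coefs ?deg // e.
have [/existsP[x /existsP[y /forall_inP h]]|] :=
    boolP [exists x, exists y, forall (g | g \in V), dot (moment x) g == y].
  exists x, y => f fU; rewrite horner_coefs ?deg //; apply/eqP/h.
  by rewrite inE map_f.
rewrite negb_exists => /forallP spread.
have {}spread x y : exists2 g, g \in V & dot (moment x) g != y.
  have := spread x; rewrite negb_exists => /forallP/(_ y).
  by rewrite negb_forall_in => /exists_inP[g gV gy]; exists g.
exfalso.
have s2 : (sqrt (INR #|F|) ^+ 2)%R = (#|F|%:R)%R :> R.
  by rewrite -INRE expr2; apply: sqrt_sqrt; apply: pos_INR.
(* The order is odd, so it is not 10. *)
have q11 : (11 <= (#|F|%:R : R))%R.
  by rewrite ler_nat ltn_neqAle q9 andbT; apply: contraTneq oddF => <-.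
set s := sqrt _ in hU s2.
have s0 : (0 < s)%R.
  by apply/RltP; apply: sqrt_lt_R0; apply: lt_0_INR; apply/ssrnat.ltP; apply: leq_trans q9.
have hs : ((s ^+ 2) ^+ 2 - (size U)%:R < s ^+ 2 * s / 4 - 3 * s ^+ 2 / 8 - s / 8)%R.
  by move/RltP: hU; rewrite s2 !RealsE.
rewrite -s2 in q11; have [] := stability_arith s0 q11 hs.
rewrite s2 -cV => u0 mu.
by rewrite ltNge spread_bound.
Qed.
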